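(* Let $(H,\langle\cdot,\cdot\rangle)$ be a real Hilbert space, let $D\subseteq H$ be an open and convex set, let $T:D\to H$ be an operator of class $C^1$ and let $A:H\to H$ be an operator (a map) that is injective on $D$. Assume that one of the following conditions holds. (a) For all $x,y\in D$ with $A(x)\neq A(y)$ and all $z\in (x,y)$ one has $$\langle dT_{z}(y-x),A(y)-A(x)\rangle>0.$$ (b) $A$ is linear and for all $x\in D$ and $y\in H\setminus\ker A$ one has $$\langle dT_{x}(y),A(y)\rangle>0.$$ Then $T$ is injective.
   Context: For $x,y\in H$, $(x,y)=\{x+t(y-x):0<t<1\}$ denotes the open line segment with endpoints $x$ and $y$. For a differentiable operator $T:D\to H$ on an open set $D\subseteq H$, $dT_x(\cdot)$ denotes the Fréchet differential of $T$ at $x\in D$. For a linear operator $A:H\to H$, $\ker A=\{x\in H: A(x)=0\}$. $A$ injective on $D$ means that $A(x)\neq A(y)$ for all $x,y\in D$ with $x\neq y$. *)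

(* Defs.v *)
From HB Require Import structures.
From mathcomp Require Import all_boot all_order all_algebra.
From mathcomp Require Import all_classical all_reals all_analysis.

Set Implicit Arguments.
Unset Strict Implicit.
Unset Printing Implicit Defensive.

Import Order.TTheory GRing.Theory Num.Theory.
Import numFieldNormedType.Exports.

Local Open Scope classical_set_scope.
Local Open Scope ring_scope.

Definition open_segment (R : realType) (H : normedModType R) (x y : H) : set H :=
  [set x + t *: (y - x) | t in [set t : R | 0 < t < 1]].

Definition ker (R : realType) (H : normedModType R) (A : H -> H) : set H :=
  [set x | A x = 0].

(* Extended-real valued, so that an unbounded map has norm +oo; intended for
   linear L. *)
Definition op_norm (R : realType) (H : normedModType R) (L : H -> H) : \bar R :=
  ereal_sup [set (`|L v|)%:E | v in [set v : H | `|v| <= 1]].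

(* The differential ['d T x] depends only on the values of T near x. Hence, for
   D open, a map D -> H of class C^1 is encoded by any total extension T of it. *)
Definition class_C1 (R : realType) (H : normedModType R) (D : set H)
    (T : H -> H) : Prop :=
  (forall x, D x -> differentiable T x) /\
  (forall x, D x ->
    op_norm (fun v => 'd T z v - 'd T x v) @[z --> within D (nbhs x)] --> 0%E).

(* Main.v *)
(* If T x = T y, the real function t |-> <T (x + t (y - x)), A y - A x> takes
   the same value at 0 and 1, so by Rolle's theorem its derivative
   <dT_z (y - x), A y - A x> vanishes at some z in the open segment (x, y);
   since A x <> A y unless x = y, this contradicts (a), and (b) reduces to (a) by
   linearity of A. *)
Require Import Defs.
From HB Require Import structures.
From mathcomp Require Import all_boot all_order all_algebra.
From mathcomp Require Import all_classical all_reals all_analysis.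
From mathcomp Require Import ring.

Import Order.TTheory GRing.Theory Num.Theory.
Import numFieldNormedType.Exports.

Local Open Scope classical_set_scope.
Local Open Scope ring_scope.

Lemma dot_ge0 (R : realFieldType) (U : lmodType R) (dot : {dot U for idfun})
    (u : U) : 0 <= dot u u.
Proof.
have [->|u0] := eqVneq u 0; first by rewrite linear0l.
exact/ltW/neq0_dnorm_gt0.
Qed.

(** For [v != 0], the vector [dot v v *: u - dot u v *: v] is orthogonal to [v]. Its nonnegative
    square expands to [dot v v] times the difference of the two sides, and the positive factor
    cancels. *)
Lemma dot_CauchySchwarz (R : realFieldType) (U : lmodType R)
    (dot : {dot U for idfun}) (u v : U) :
  dot u v ^+ 2 <= dot u u * dot v v.
Proof.
have [->|v0] := eqVneq v 0; first by rewrite !linear0r expr0n.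
have vv_gt0 : 0 < dot v v by exact: neq0_dnorm_gt0.
have symD : dot v u = dot u v by rewrite hermC expr0 mul1r.
have := dot_ge0 _ _ dot (dot v v *: u - dot u v *: v).
rewrite linearBl !linearBr /= !linearZl_LR !linearZr_LR /= symD => h.
rewrite -subr_ge0 -(pmulr_rge0 _ vv_gt0).
suff -> : dot v v * (dot u u * dot v v - dot u v ^+ 2) =
  dot v v * (dot v v * dot u u) - dot u v * (dot v v * dot u v) -
    (dot v v * (dot u v * dot u v) - dot u v * (dot u v * dot v v)) by exact: h.
by ring.
Qed.

(** A linear map bounded near 0 is continuous; since the norm comes from [dot], Cauchy-Schwarz gives
    the bound [|w|] on the unit ball. *)
Lemma dot_continuousl (R : realType) (H : normedModType R)
    (dot : {dot H for idfun})
    (norm_dot : forall x : H, `|x| = Num.sqrt (dot x x)) (w : H) :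
  continuous (applyr dot w : H -> R).
Proof.
apply: (@bounded_linear_continuous _ _ _ (applyr dot w)).
apply/ex_bound; exists `|w|; apply/nbhs_normP; exists 1 => //= x /=.
rewrite sub0r normrN => x1.
apply: (@le_trans _ _ (`|x| * `|w|)).
  rewrite !norm_dot -sqrtrM ?dot_ge0 // -sqrtr_sqr.
  exact/ler_wsqrtr/dot_CauchySchwarz.
by rewrite ler_piMl// ltW.
Qed.

(** Chain rule for an affine line, then [T], then a continuous linear form, which is its own
    differential. *)
Lemma is_derive_dot_line (R : realType) (H : normedModType R)
    (dot : {dot H for idfun})
    (norm_dot : forall x : H, `|x| = Num.sqrt (dot x x))
    (T : H -> H) (x v w : H) (t : R) :
  differentiable T (x + t *: v) ->
  is_derive t 1 (fun s : R => dot (T (x + s *: v)) w)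
    (dot ('d T (x + t *: v) v) w).
Proof.
move=> dT; pose line := cst x + ( *:%R ^~ v : R -> H).
have dline : is_diff t line (0 + ( *:%R ^~ v : R -> H)).
  exact: is_diffD.
have cw := @dot_continuousl R H dot norm_dot w.
have dw z : is_diff z (applyr dot w : H -> R) (applyr dot w).
  by apply: DiffDef; [exact: linear_differentiable|rewrite diff_lin].
have dTl : is_diff (line t) T ('d T (line t)) by exact: DiffDef.
have := @is_diff_comp _ _ _ _ (T \o line) _ (applyr dot w : H -> R) _ t _ (dw _).
move=> /(_ _ (is_diff_comp dline dTl)) dg.
case: dg => dgt diff_g.
apply: DeriveDef; first exact: diff_derivable.
by rewrite (deriveE (1 : R^o) dgt) diff_g /= !fctE scale1r add0r.
Qed.

Lemma convex_set_segment (R : realType) (H : normedModType R) (D : set H)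
    (x y : H) (t : R) :
  convex_set D -> D x -> D y -> 0 <= t <= 1 -> D (x + t *: (y - x)).
Proof.
move=> cD Dx Dy t01.
(* The weight [t] falls on the first point of a convex combination, hence the order [y], [x]. *)
have := cD y x (@Itv01 R t (proj1 (andP t01)) (proj2 (andP t01))).
rewrite !inE => /(_ Dy Dx); congr (D _).
by rewrite /conv /= scalerBl scale1r scalerBr addrCA.
Qed.

Theorem theorem2p1 (R : realType) (H : completeNormedModType R)
    (dot : {dot H for idfun})
    (norm_dot : forall x : H, `|x| = Num.sqrt (dot x x))
    (D : set H) (openD : open D) (convexD : convex_set D)
    (T : H -> H) (C1_T : class_C1 D T)
    (A : H -> H) (injA : {in D &, injective A}) :
  ((forall x y : H, D x -> D y -> A x <> A y ->
      forall z : H, open_segment x y z -> 0 < dot ('d T z (y - x)) (A y - A x))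
   \/
   (linear A /\
    forall x y : H, D x -> ~ ker A y -> 0 < dot ('d T x y) (A y))) ->
  {in D &, injective T}.
Proof.
move=> hyp x y xD yD Txy; apply: contrapT => xy.
have [Dx Dy] : D x /\ D y by move: xD yD; rewrite !inE.
have Axy : A x <> A y by move=> /(injA _ _ xD yD).
have Dseg (t : R) : 0 <= t <= 1 -> D (x + t *: (y - x)).
  exact: convex_set_segment.
(* Both alternatives yield this positivity. Under (b), [y - x] lies outside [ker A] because
   [A (y - x) = A y - A x] is nonzero. *)
have pos (t : R) : 0 < t < 1 -> 0 < dot ('d T (x + t *: (y - x)) (y - x)) (A y - A x).
  move=> t01; case: hyp => [hyp|[linA hyp]]; first by apply: hyp => //; exists t.
  have AB : A (y - x) = A y - A x by exact: (zmod_morphism_linear linA).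
  rewrite -AB; apply: hyp.
    by apply: Dseg; case/andP: t01 => /ltW -> /ltW ->.
  by rewrite /ker /= AB => /eqP; rewrite subr_eq0 eq_sym => /eqP.
pose g (s : R) := dot (T (x + s *: (y - x))) (A y - A x).
(* The endpoints are included, since [x] and [y] lie in [D]: this one fact gives Rolle both
   derivability inside and continuity on the closed interval. *)
have dg (t : R) : t \in `[0, 1] ->
    is_derive t 1 g (dot ('d T (x + t *: (y - x)) (y - x)) (A y - A x)).
  rewrite in_itv /= => /Dseg Dt; apply: is_derive_dot_line => //.
  exact: C1_T.1.
have [|||c c01 [_ gc]] := @Rolle R g 0 1 ltr01.
- by move=> t /subset_itv_oo_cc /dg.
- by apply: derivable_within_continuous => t /dg.
- by rewrite /g scale0r addr0 scale1r subrKC Txy.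
have [_ gc'] := dg c (subset_itv_oo_cc c01).
have : 0 < dot ('d T (x + c *: (y - x)) (y - x)) (A y - A x).
  by apply: pos; rewrite in_itv in c01.
by rewrite -gc' gc ltxx.
Qed.
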